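(* Let $(\mathfrak X,\|\cdot\|)$ be a Banach space and let $\mu$ be a Borel probability measure on $\mathfrak X$ with $\int_{\mathfrak X}\|x\|\,\mu(dx)<\infty$. Then for every $n\in\mathbb N$ $$e_{2n}^{\mathrm{ran}}\le 2\cdot n^{-1/2}\cdot q_n^{(2)} ,$$ where $e_{2n}^{\mathrm{ran}}$ is the $2n$-th minimal worst case error of (broad sense) randomized algorithms for integrating Lipschitz functionals with respect to $\mu$, and $q^{(2)}_n$ is the $n$-th quantization number of $\mu$ of order two.
   Context: $\mathbb N=\{1,2,\dots\}$. $F$ denotes the class of all functionals $f:\mathfrak X\to\mathbb R$ with $|f(x)-f(y)|\le\|x-y\|$ for all $x,y\in\mathfrak X$, and $S(f)=\int_{\mathfrak X}f(x)\,\mu(dx)$ for $f\in F$. Deterministic algorithms. $\mathbb S^{\mathrm{det}}$ is the class of all mappings $\widehat S:F\to\mathbb R$ arising as follows from a point $x_1\in\mathfrak X$ and arbitrary mappings $\psi_\ell:\mathbb R^{\ell-1}\to\mathfrak X$ ($\ell\ge2$), $\tau_\ell:\mathbb R^\ell\to\{0,1\}$ ($\ell\ge1$), $\phi_\ell:\mathbb R^\ell\to\mathbb R$ ($\ell\ge1$). For $f\in F$ put $y_1=f(x_1)$ and $y_\ell=f(\psi_\ell(y_1,\dots,y_{\ell-1}))$ for $\ell\ge2$; let $n(f)=\min\{\ell\ge1:\tau_\ell(y_1,\dots,y_\ell)=1\}$, which is assumed to be finite for every $f\in F$; then $\widehat S(f)=\phi_{n(f)}(y_1,\dots,y_{n(f)})$.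 The mapping $\widehat S$ is identified with these data, and $\mathrm{card}(\widehat S,f)=n(f)$. Randomized algorithms. $\mathbb S^{\mathrm{ran}}$ is the class of all mappings $\widehat S:\Omega\times F\to\mathbb R$, on any probability space $(\Omega,\mathfrak A,P)$, such that (i) $\widehat S(\omega,\cdot)\in\mathbb S^{\mathrm{det}}$ for every $\omega\in\Omega$; (ii) $\widehat S(\cdot,f)$ is measurable for every $f\in F$; (iii) $\omega\mapsto\mathrm{card}(\widehat S(\omega,\cdot),f)$ is measurable for every $f\in F$. The random variables in (ii), (iii) are written $\widehat S(f)$ and $\mathrm{card}(\widehat S,f)$. Define $e(\widehat S)=\sup_{f\in F}(\mathbb E|S(f)-\widehat S(f)|^2)^{1/2}$ and $\mathrm{card}(\widehat S)=\sup_{f\in F}\mathbb E(\mathrm{card}(\widehat S,f))$ (for simplicity assumed to belong to $\mathbb N$), and $$e_n^{\mathrm{ran}}=\inf\{e(\widehat S):\widehat S\in\mathbb S^{\mathrm{ran}},\ \mathrm{card}(\widehat S)\le n\}.$$ Quantization numbers. For $r>0$, $q_n^{(r)}=\inf_{x_1,\dots,x_n\in\mathfrak X}\left(\int_{\mathfrak X}\min_{i=1,\dots,n}\|x-x_i\|^r\,\mu(dx)\right)^{1/r}$. *)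

(* Defs.v *)
From mathcomp Require Import all_boot all_order all_algebra.
From mathcomp Require Import all_classical all_reals all_analysis.

Set Implicit Arguments.
Unset Strict Implicit.
Unset Printing Implicit Defensive.

Import Order.TTheory GRing.Theory Num.Theory.
Import numFieldNormedType.Exports.

Local Open Scope classical_set_scope.
Local Open Scope ring_scope.

(* The space X with its Borel sigma-algebra; as a type it is convertible
   to X itself. *)
Notation borel X := (g_sigma_algebraType (@open X)).

(* The class F of functionals with Lipschitz constant at most one. *)
Record lipschitz1 (R : realType) (X : completeNormedModType R) := Lipschitz1 {
  lip_fun :> X -> R;
  lip_funP : forall x y : X, `|lip_fun x - lip_fun y| <= `|x - y| }.

Section DeterministicAlgorithms.
Variables (R : realType) (X : completeNormedModType R).

(* The type seq R is the disjoint union of the spaces R^l, l >= 0,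
   so one function on seq R encodes a family of functions on the R^l,
   through its restrictions to the sequences of size l. *)

(* [observations psi f l] is (y_1, ..., y_l), where
   y_(l+1) = f (psi (y_1, ..., y_l)) and psi [::] is the first node x_1. *)
Fixpoint observations (psi : seq R -> X) (f : X -> R) (l : nat) : seq R :=
  if l is k.+1 then
    let y := observations psi f k in rcons y (f (psi y))
  else [::].

(* Neither the value of [tau] nor that of [phi] at [::] is ever used. *)
Record det_algorithm := DetAlgorithm {
  psi : seq R -> X;
  tau : seq R -> bool;
  phi : seq R -> R;
  det_halts : forall f : lipschitz1 X,
    exists l : nat, (0 < l)%N && tau (observations psi f l) }.

Definition det_card (A : det_algorithm) (f : lipschitz1 X) : nat :=
  ex_minn (det_halts A f).

Definition det_output (A : det_algorithm) (f : lipschitz1 X) : R :=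
  phi A (observations (psi A) f (det_card A f)).

End DeterministicAlgorithms.

Section RandomizedAlgorithms.
Variables (R : realType) (X : completeNormedModType R).
Variable mu : probability (borel X) R.

Definition integral_functional (f : lipschitz1 X) : R := \int[mu]_x f x.

Section OnProbabilitySpace.
Variables (d : measure_display) (Omega : measurableType d).
Variable P : probability Omega R.

Definition ran_algorithm (A : Omega -> det_algorithm X) : Prop :=
  forall f : lipschitz1 X,
    measurable_fun setT (fun w : Omega => det_output (A w) f) /\
    measurable_fun setT (fun w : Omega => det_card (A w) f).

Definition ran_error (A : Omega -> det_algorithm X) : \bar R :=
  ereal_sup (range (fun f : lipschitz1 X =>
    ('E_P[fun w => (`|integral_functional f - det_output (A w) f| ^+ 2)%R]
       `^ 2^-1)%E)).

Definition ran_card (A : Omega -> det_algorithm X) : \bar R :=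
  ereal_sup (range (fun f : lipschitz1 X =>
    ('E_P[fun w => (det_card (A w) f)%:R%R])%E)).

End OnProbabilitySpace.

(* The cardinality of an admissible algorithm is a positive integer k. *)
Definition minimal_ran_error (n : nat) : \bar R :=
  ereal_inf [set e : \bar R |
    exists (d : measure_display) (Omega : measurableType d)
           (P : probability Omega R) (A : Omega -> det_algorithm X),
      [/\ ran_algorithm A,
          exists2 k : nat, (0 < k)%N & ran_card P A = k%:R%:E,
          (ran_card P A <= n%:R%:E)%E
        & e = ran_error P A]].

(* The minimum is taken in \bar R, where +oo is neutral. *)
Definition quantization_number (r : R) (n : nat) : \bar R :=
  ereal_inf (range (fun a : 'I_n -> X =>
    ((\int[mu]_x \big[mine/+oo]_(i < n) (`|(x : X) - a i| `^ r)%R%:E)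
       `^ r^-1)%E)).

End RandomizedAlgorithms.

(* Main.v *)
Require Import Defs.
From mathcomp Require Import all_boot all_order all_algebra.
From mathcomp Require Import all_classical all_reals all_analysis.
From mathcomp Require Import measurable_realfun ring lra.

Set Implicit Arguments.
Unset Strict Implicit.
Unset Printing Implicit Defensive.

Import Order.TTheory GRing.Theory Num.Theory.
Import numFieldNormedType.Exports.
Local Open Scope classical_set_scope.
Local Open Scope ring_scope.

(** The upper bound is achieved by Monte Carlo integration with a piecewise
    constant control variate.  Fix nodes a_1, ..., a_n and let p x be a node
    nearest to x, chosen measurably ([measurable_argmin]).  Then
    S(f) = S(f o p) + S(f - f o p).  The first summand is a
    linear combination of f(a_1), ..., f(a_n) whose weights do not depend on f,
    so it is known exactly after n evaluations.  The second summand is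
    estimated by the mean of f(Y_j) - f(p(Y_j)) over an independent sample
    Y_1, ..., Y_n of mu; as f o p only takes the values f(a_i) already observed,
    this takes n further evaluations, hence 2n in total, for every f and every
    outcome of the sample ([sampling_algorithm]).

    The estimate is unbiased, so its mean square error is 1/n times the variance
    of f - f o p under mu, which is at most 1/n times the integral of
    |f x - f (p x)|^2 ([monte_carlo_sample]).  The Lipschitz condition bounds
    this integrand by |x - p x|^2 = min_i |x - a_i|^2.  Taking square roots
    gives the bound for fixed nodes ([minimal_ran_error_le_nodes]), and the
    infimum over the nodes gives the theorem. *)

(** * Measurability *)

(** Open intervals generate the Borel sets of the line, and their preimages
    under a continuous functional are open, hence Borel, even when the Banach
    space is not separable. *)
Lemma lipschitz_measurable (R : realType) (X : completeNormedModType R)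
    (f : X -> R) :
  (forall x y, `|f x - f y| <= `|x - y|) ->
  measurable_fun setT (f : borel X -> R).
Proof.
move=> lipf.
have cf : continuous f.
  move=> x; apply/cvgrPdist_lt => e e0; near=> y.
  by rewrite (le_lt_trans (lipf x y)).
apply: (measurability _ (RGenOpens.measurableE R)).
move=> _ [_ [a [b ->]] <-]; rewrite setTI; apply: sub_sigma_algebra.
by apply: open_comp => //; exact: interval_open.
Unshelve. all: by end_near. Qed.

(** Induction on the number of functions: the new index replaces the old one
    on the measurable set where the new value is not larger.  The last clause
    expresses that t is measurable in the form in which it is used, namely that
    branching on t preserves measurability. *)
Lemma measurable_argmin d (T : measurableType d) (R : realType)
    (D : nat -> T -> R) (n : nat) :
  (forall i, measurable_fun setT (D i)) ->
  exists t : T -> nat,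
    [/\ forall x, (t x <= n)%N,
        forall x i, (i <= n)%N -> D (t x) x <= D i x
      & forall F : nat -> T -> R, (forall i, measurable_fun setT (F i)) ->
          measurable_fun setT (fun x => F (t x) x)].
Proof.
move=> mD; elim: n => [|n [t [tn tmin tF]]].
  exists (fun=> 0%N); split => // x i; by rewrite leqn0 => /eqP ->.
exists (fun x => if D n.+1 x <= D (t x) x then n.+1 else t x); split.
- by move=> x; case: ifP => // _; rewrite ltnW// ltnS.
- move=> x i; rewrite leq_eqVlt ltnS => /predU1P[->|/tmin tx].
    by case: ifP => // /negbT; rewrite -ltNge => /ltW.
  by case: ifP => // /le_trans; apply.
- move=> F mF; rewrite (_ : (fun x => _) = (fun x =>
      if D n.+1 x <= D (t x) x then F n.+1 x else F (t x) x)); last first.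
    by apply/funext => x; case: ifP.
  apply: measurable_fun_ifT => //; last exact: tF.
  by apply: measurable_fun_ler => //; exact: tF.
Qed.

(** * Second moments and independent samples *)

Section second_moments.
Context d (T : measurableType d) (R : realType) (mu : probability T R).

Lemma integral_probability_cst (c : R) : (\int[mu]_x c%:E = c%:E)%E.
Proof. by have := expectation_cst mu c; rewrite unlock. Qed.

(** The cross term of the square integrates to a multiple of the mean of h. *)
Lemma second_moment_shift (h : T -> R) (c : R) :
  mu.-integrable setT (EFin \o h) ->
  mu.-integrable setT (EFin \o (fun x => h x ^+ 2)) ->
  (\int[mu]_x (h x)%:E = 0)%E ->
  (\int[mu]_x ((c + h x) ^+ 2)%:E =
   (c ^+ 2)%:E + \int[mu]_x (h x ^+ 2)%:E)%E.
Proof.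
move=> ih ih2 h0.
have ich : mu.-integrable setT (EFin \o (fun x => 2 * c * h x)).
  exact: (integrableZl measurableT (2 * c)%R ih).
have icst := finite_measure_integrable_cst mu (c ^+ 2) measurableT.
transitivity (\int[mu]_x (((c ^+ 2)%:E + (2 * c * h x)%:E) + (h x ^+ 2)%:E))%E.
  by apply: eq_integral => x _; rewrite -!EFinD; congr EFin; ring.
rewrite integralD//; last exact: (integrableD measurableT icst ich).
rewrite (integralD measurableT icst ich) integral_probability_cst.
have -> : (\int[mu]_x (2 * c * h x)%:E = 0)%E.
  by rewrite [LHS](integralZl measurableT ih) h0 mule0.
by rewrite adde0.
Qed.

Lemma integrable_sqr_shift (h : T -> R) (c : R) :
  measurable_fun setT h ->
  mu.-integrable setT (EFin \o (fun x => h x ^+ 2)) ->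
  mu.-integrable setT (EFin \o (fun x => (h x - c) ^+ 2)).
Proof.
move=> mh ih2.
have icst := finite_measure_integrable_cst mu (2 * c ^+ 2) measurableT.
have ih2' := integrableZl measurableT 2%R ih2.
apply: (le_integrable measurableT _ _ (integrableD measurableT ih2' icst)).
  apply/measurable_EFinP; apply: measurable_funX.
  by apply: measurable_funB.
move=> x _; rewrite /= lee_fin.
have c0 := sqr_ge0 c; have hx0 := sqr_ge0 (h x); have hc := sqr_ge0 (h x + c).
rewrite !ger0_norm; [nra|nra|exact: sqr_ge0].
Qed.

Lemma integral_centered (h : T -> R) :
  mu.-integrable setT (EFin \o h) ->
  (\int[mu]_x (h x - \int[mu]_y h y)%R%:E = 0)%E.
Proof.
move=> ih; set m := (\int[mu]_y h y)%R.
have icst := finite_measure_integrable_cst mu m measurableT.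
rewrite [LHS](integralB measurableT ih icst) integral_probability_cst.
by rewrite /m /Rintegral fineK ?subee//; exact: integrable_fin_num.
Qed.

(** Subtracting the mean m lowers the second moment, by exactly m ^+ 2. *)
Lemma centered_second_moment_le (h : T -> R) :
  mu.-integrable setT (EFin \o h) ->
  mu.-integrable setT (EFin \o (fun x => h x ^+ 2)) ->
  (\int[mu]_x ((h x - \int[mu]_x h x) ^+ 2)%:E <=
   \int[mu]_x (h x ^+ 2)%:E)%E.
Proof.
move=> ih ih2; set m := \int[mu]_x h x.
have icst := finite_measure_integrable_cst mu m measurableT.
have mh : measurable_fun setT h by apply/measurable_EFinP/(measurable_int mu).
have ihm : mu.-integrable setT (EFin \o (fun x => h x - m)).
  exact: (integrableB measurableT ih icst).
rewrite [leRHS](_ : _ = (m ^+ 2)%:E + \int[mu]_x ((h x - m) ^+ 2)%:E)%E.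
  by rewrite leeDr// lee_fin sqr_ge0.
rewrite -second_moment_shift//.
- by apply: eq_integral => x _; rewrite addrC subrK.
- exact: integrable_sqr_shift.
- exact: integral_centered.
Qed.

End second_moments.

(** Independence is expressed by the product measure: for fixed w the inner
    integral is that of a centered function shifted by the constant g w. *)
Lemma second_moment_indep_sum d1 d2 (W : measurableType d1)
    (T : measurableType d2) (R : realType) (P : probability W R)
    (mu : probability T R) (g : W -> R) (h : T -> R) :
  measurable_fun setT g ->
  mu.-integrable setT (EFin \o h) ->
  mu.-integrable setT (EFin \o (fun x => h x ^+ 2)) ->
  (\int[mu]_x (h x)%:E = 0)%E ->
  (\int[P \x mu]_z ((g z.1 + h z.2) ^+ 2)%:E =
   \int[P]_w (g w ^+ 2)%:E + \int[mu]_x (h x ^+ 2)%:E)%E.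
Proof.
move=> mg ih ih2 h0.
have mh : measurable_fun setT h by apply/measurable_EFinP/(measurable_int mu).
rewrite (fubini_tonelli1 (fun z : W * T => ((g z.1 + h z.2) ^+ 2)%:E));
  last 2 first.
- apply/measurable_EFinP; apply: measurable_funX; apply: measurable_funD.
    exact: measurableT_comp.
  exact: measurableT_comp.
- by move=> z; rewrite lee_fin sqr_ge0.
rewrite /fubini_F /=.
under eq_integral => w _ do rewrite second_moment_shift//.
have i0 : (0 <= \int[mu]_x (h x ^+ 2)%:E)%E.
  by apply: integral_ge0 => x _; rewrite lee_fin sqr_ge0.
rewrite ge0_integralD//; last 2 first.
- by move=> w _; rewrite lee_fin sqr_ge0.
- by apply/measurable_EFinP; exact: measurable_funX.
by rewrite integral_cst//= probability_setT mule1.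
Qed.

(** The sample space is built by adjoining one factor of mu at a time.  The only
    consequence of independence that the variance needs, the additivity of
    second moments of centered functions, is carried through the induction in
    place of independence itself. *)
Lemma independent_sample d (T : measurableType d) (R : realType)
    (mu : probability T R) (n : nat) :
  exists (d' : measure_display) (W : measurableType d') (P : probability W R)
         (Y : nat -> W -> T),
    (forall i, measurable_fun setT (Y i)) /\
    forall h : T -> R,
      mu.-integrable setT (EFin \o h) ->
      mu.-integrable setT (EFin \o (fun x => h x ^+ 2)) ->
      (\int[mu]_x (h x)%:E = 0)%E ->
      (\int[P]_w ((\sum_(i < n) h (Y i w)) ^+ 2)%:E =
       n%:R%:E * \int[mu]_x (h x ^+ 2)%:E)%E.
Proof.
elim: n => [|n [d' [W [P [Y [mY YE]]]]]].
  (* An empty sample can live on any probability space. *)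
  exists d, T, mu, (fun _ => id); split => // h _ _ _.
  rewrite mul0e; under eq_integral do rewrite big_ord0 expr0n.
  exact: integral0.
exists _, (W * T)%type, (P \x mu)%E,
  (fun i z => if (i < n)%N then Y i z.1 else z.2); split.
  move=> i; case: (i < n)%N => /=; last exact: measurable_snd.
  exact: (measurableT_comp (mY i) measurable_fst).
move=> h ih ih2 h0.
have mh : measurable_fun setT h by apply/measurable_EFinP/(measurable_int mu).
under eq_integral => z _.
  rewrite big_ord_recr/= ltnn.
  under eq_bigr => i _ do rewrite ltn_ord.
  over.
rewrite (@second_moment_indep_sum _ _ _ _ _ _ _
  (fun w => \sum_(i < n) h (Y i w)))//.
  rewrite YE// -[in RHS]addn1 natrD EFinD muleDl// ?mul1e//.
  exact: integrable_fin_num.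
apply: measurable_sum => i; exact: (measurableT_comp mh).
Qed.

(** The error of the sample mean is the mean of n independent centered terms:
    its second moment is n^-1 ^+ 2 * n = n^-1 times that of one term, and
    centering does not increase second moments. *)
Lemma monte_carlo_sample d (T : measurableType d) (R : realType)
    (mu : probability T R) (n : nat) : (0 < n)%N ->
  exists (d' : measure_display) (W : measurableType d') (P : probability W R)
         (Y : nat -> W -> T),
    (forall i, measurable_fun setT (Y i)) /\
    forall h : T -> R,
      mu.-integrable setT (EFin \o h) ->
      mu.-integrable setT (EFin \o (fun x => h x ^+ 2)) ->
      (\int[P]_w ((\int[mu]_x h x - n%:R^-1 * \sum_(i < n) h (Y i w)) ^+ 2)%R%:E
         <= n%:R^-1%:E * \int[mu]_x (h x ^+ 2)%:E)%E.
Proof.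
move=> n0; have [d' [W [P [Y [mY YE]]]]] := independent_sample mu n.
exists d', W, P, Y; split => // h ih ih2.
have nN0 : n%:R != 0 :> R by rewrite pnatr_eq0 -lt0n.
have mh : measurable_fun setT h by apply/measurable_EFinP/(measurable_int mu).
set m := (\int[mu]_x h x)%R.
pose g x := h x - m.
have icst := finite_measure_integrable_cst mu m measurableT.
have ig : mu.-integrable setT (EFin \o g) := integrableB measurableT ih icst.
have ig2 : mu.-integrable setT (EFin \o (fun x => g x ^+ 2)).
  exact: integrable_sqr_shift.
have g0 : (\int[mu]_x (g x)%:E = 0)%E by exact: integral_centered.
rewrite (_ : \int[P]_w _ =
    (n%:R^-1 ^+ 2)%:E * \int[P]_w ((\sum_(i < n) g (Y i w)) ^+ 2)%:E)%E.
  rewrite (YE g)// muleA -EFinM expr2 -mulrA mulVf// mulr1.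
  by rewrite lee_pmul2l ?lte_fin ?invr_gt0 ?ltr0n// centered_second_moment_le.
rewrite -ge0_integralZl_EFin ?sqr_ge0//; last 2 first.
- by move=> w _; rewrite lee_fin sqr_ge0.
- apply/measurable_EFinP/measurable_funX/measurable_sum => i.
  apply: measurableT_comp (mY i).
  by apply: measurable_funB.
apply: eq_integral => w _; rewrite -EFinM -exprMn; congr (_%:E).
rewrite -sqrrN; congr (_ ^+ 2).
rewrite /g sumrB sumr_const card_ord mulrBr -[m *+ n]mulr_natl.
by rewrite mulKf// opprB.
Qed.

(** * Nonadaptive algorithms *)

Section sampling_algorithm.
Context (R : realType) (X : completeNormedModType R).
Variables (z : nat -> X) (N : nat) (N_gt0 : (0 < N)%N) (out : seq R -> R).

(* The number of observations made so far is the index of the next node. *)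
Let nodes (y : seq R) := z (size y).

Lemma observations_sampling (f : X -> R) l :
  observations nodes f l = mkseq (f \o z) l.
Proof. by elim: l => //= l ->; rewrite /nodes size_mkseq mkseqS. Qed.

Lemma sampling_halts (f : lipschitz1 X) :
  exists l, (0 < l)%N && (size (observations nodes f l) == N).
Proof. by exists N; rewrite observations_sampling size_mkseq N_gt0 /=. Qed.

Definition sampling_algorithm : det_algorithm X :=
  @DetAlgorithm R X nodes (fun y => size y == N) out sampling_halts.

Lemma sampling_card (f : lipschitz1 X) : det_card sampling_algorithm f = N.
Proof.
rewrite /det_card; case: ex_minnP => l /=.
by rewrite observations_sampling size_mkseq => /andP[_ /eqP].
Qed.

Lemma sampling_output (f : lipschitz1 X) :
  det_output sampling_algorithm f = out (mkseq (f \o z) N).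
Proof. by rewrite /det_output sampling_card observations_sampling. Qed.

End sampling_algorithm.

(** * The control variate algorithm *)

Section fixed_nodes.
Context (R : realType) (X : completeNormedModType R).
Variable mu : probability (borel X) R.
Hypothesis mu_moment1 : (\int[mu]_x `|(x : X)|%:E < +oo)%E.

Lemma integrable_norm_id :
  mu.-integrable setT (EFin \o (fun x : borel X => `|x : X|)).
Proof.
apply/integrableP; split.
  apply/measurable_EFinP; apply: lipschitz_measurable => x y.
  exact: ler_dist_dist.
by under eq_integral => x _ do rewrite /= normr_id.
Qed.

(** This gives S(f) its meaning: a Lipschitz functional grows at most like the
    norm, which has finite mean. *)
Lemma lipschitz_integrable (f : lipschitz1 X) :
  mu.-integrable setT (EFin \o (f : borel X -> R)).
Proof.
have icst := finite_measure_integrable_cst mu `|f 0| measurableT.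
apply: (le_integrable measurableT _ _
  (integrableD measurableT integrable_norm_id icst)).
  by apply/measurable_EFinP; apply: lipschitz_measurable; exact: lip_funP.
move=> x _; rewrite /= lee_fin [leRHS]ger0_norm ?addr_ge0//.
have := lip_funP f x 0; rewrite subr0 => fx.
by rewrite -[f x in leLHS](subrK (f 0)) (le_trans (ler_normD _ _))// lerD2r.
Qed.

(** This is the error bound of the control variate algorithm with fixed nodes a
    followed by n random nodes.  It uses 2 * n evaluations for every f and every
    outcome of the sample, so its cardinality is 2 * n. *)
Lemma minimal_ran_error_le_nodes (n : nat) (a : 'I_n -> X) : (0 < n)%N ->
  (minimal_ran_error mu (2 * n) <=
   (n%:R `^ (- 2^-1))%:E *
     (\int[mu]_x \big[mine/+oo]_(i < n) (`|(x : X) - a i| `^ 2)%R%:E)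
       `^ 2^-1)%E.
Proof.
case: n a => // n a _.
(* Nodes are indexed by nat, to match positions in the list of observations. *)
pose b k := a (inord k).
have mdist k : measurable_fun setT (fun x : borel X => `|(x : X) - b k|).
  apply: lipschitz_measurable => x y.
  by rewrite (le_trans (ler_dist_dist _ _))// opprB addrA subrK.
have [t [tn tmin mt]] := measurable_argmin n mdist.
have -> : (\int[mu]_x \big[mine/+oo]_(i < n.+1) (`|(x : X) - a i| `^ 2)%R%:E =
           \int[mu]_x (`|(x : X) - b (t x)| ^+ 2)%R%:E)%E.
  apply: eq_integral => x _; apply/eqP; rewrite eq_le; apply/andP; split.
    apply: (@bigmin_inf _ _ _ _ (inord (t x))) => //.
    by rewrite powR_mulrn.
  apply/bigmin_geP; split => [|i _]; first exact: leey.
  rewrite lee_fin powR_mulrn// lerXn2r ?nnegrE//.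
  by rewrite (le_trans (tmin x i _)) ?leq_ord// /b inord_val.
set I := (\int[mu]_x _)%E.
have I0 : (0 <= I)%E by apply: integral_ge0 => x _; rewrite lee_fin sqr_ge0.
have c0 : 0 < n.+1%:R `^ (- 2^-1) :> R by rewrite powR_gt0.
(* With an infinite second moment of the distance the bound is +oo. *)
have [->|] := eqVneq I +oo%E.
  by rewrite poweRyr// gt0_muley ?leey// lte_fin.
rewrite -ltey => Ioo.
have [d [W [P [Y [mY YE]]]]] := monte_carlo_sample mu (ltn0Sn n).
(* The fixed nodes occupy positions 0, ..., n and the sample the positions
   n.+1, ..., 2 * n.+1 - 1; position t x holds the value at the fixed node
   nearest to x. *)
pose z w k := if (k < n.+1)%N then b k else Y (k - n.+1)%N w : X.
(* The integral of y`_(t x) is the weighted sum of the first n.+1 observations,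
   the weight of y`_i being the measure of the cell where t equals i. *)
pose out w (y : seq R) := \int[mu]_x y`_(t x) +
  n.+1%:R^-1 * \sum_(j < n.+1) (y`_(n.+1 + j) - y`_(t (Y j w))).
have N0 : (0 < 2 * n.+1)%N by rewrite muln_gt0.
pose A w := sampling_algorithm (z w) N0 (out w).
have tlt x : (t x < n.+1)%N by rewrite ltnS.
(* r f is the residual of f after subtracting its control variate f o b o t. *)
pose r (f : lipschitz1 X) (x : borel X) := f x - f (b (t x)).
have mf (f : lipschitz1 X) : measurable_fun setT (f : borel X -> R).
  by apply: lipschitz_measurable; exact: lip_funP.
have mfb (f : lipschitz1 X) :
    measurable_fun setT (fun x : borel X => f (b (t x))).
  by apply: (mt (fun k _ => f (b k))) => i; exact: measurable_cst.
have mr f : measurable_fun setT (r f) by apply: measurable_funB.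
have mproj : measurable_fun setT (fun x : borel X => `|(x : X) - b (t x)|).
  exact: (mt (fun k x => `|(x : X) - b k|)).
have r_le f x : r f x ^+ 2 <= `|(x : X) - b (t x)| ^+ 2.
  by rewrite -[leLHS]real_normK ?num_real// lerXn2r ?nnegrE// lip_funP.
have ir2 f : mu.-integrable setT (EFin \o (fun x => r f x ^+ 2)).
  apply/integrableP; split; first exact/measurable_EFinP/measurable_funX.
  apply: le_lt_trans Ioo; apply: ge0_le_integral => //.
  - by apply: measurableT_comp => //; exact/measurable_EFinP/measurable_funX.
  - exact/measurable_EFinP/measurable_funX.
  - by move=> x _; rewrite /= ger0_norm ?sqr_ge0// lee_fin.
have ifb (f : lipschitz1 X) :
    mu.-integrable setT (EFin \o (fun x => f (b (t x)))).
  have icst := finite_measure_integrable_cst mu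
    (\sum_(i < n.+1) `|f (b i)|) measurableT.
  apply: (le_integrable measurableT _ _ icst); first exact/measurable_EFinP.
  move=> x _; rewrite /= lee_fin [leRHS]ger0_norm ?sumr_ge0//.
  by rewrite (bigD1 (Ordinal (tn x : (t x < n.+1)%N)))//= lerDl sumr_ge0.
have ir f : mu.-integrable setT (EFin \o r f).
  exact: (integrableB measurableT (lipschitz_integrable f) (ifb f)).
have outE w f : det_output (A w) f =
    \int[mu]_x f (b (t x)) + n.+1%:R^-1 * \sum_(j < n.+1) r f (Y j w).
  rewrite sampling_output /out; congr (_ + _ * _).
    apply: eq_Rintegral => x _.
    rewrite nth_mkseq ?(leq_trans (tlt x)) ?leq_pmull//.
    by rewrite /= /z tlt.
  apply: eq_bigr => j _.
  rewrite !nth_mkseq ?mul2n -?addnn ?ltn_add2l// ?ltn_addr//.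
  by rewrite /= /z tlt ltnNge leq_addr/= addKn.
have cardE w f : det_card (A w) f = (2 * n.+1)%N by exact: sampling_card.
have ran_cardE : ran_card P A = (2 * n.+1)%:R%:E.
  (* A supremum of a constant family requires some member of F. *)
  have f0 : lipschitz1 X by exists (cst 0) => x y; rewrite subrr normr0.
  rewrite /ran_card (_ : (fun f => _) = cst (2 * n.+1)%:R%:E).
    by apply: ereal_sup_cst; apply/set0P; exists f0.
  apply/funext => f; rewrite -[RHS](expectation_cst P) unlock.
  by apply: eq_integral => w _; rewrite cardE.
apply: (@le_trans _ _ (ran_error mu P A)).
  apply: ereal_inf_lbound; exists d, W, P, A; split => //.
  - move=> f; split.
    + under eq_fun do rewrite outE.
      apply: measurable_funD => //; apply: measurable_funM => //.
      by apply: measurable_sum => j; exact: (measurableT_comp (mr f) (mY j)).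
    + by rewrite (funext (cardE^~ f)); exact: measurable_cst.
  - by exists (2 * n.+1)%N.
  - by rewrite ran_cardE.
apply: ge_ereal_sup => _ [f _ <-].
apply: (@le_trans _ _ ((n.+1%:R^-1%:E * I) `^ 2^-1)%E).
  apply: gt0_ler_poweR; rewrite ?in_itv/= ?leey ?andbT//.
  - by rewrite unlock integral_ge0// => w _; rewrite lee_fin sqr_ge0.
  - by rewrite mule_ge0.
  apply: (@le_trans _ _ (n.+1%:R^-1%:E * \int[mu]_x (r f x ^+ 2)%:E)%E).
    have -> : (fun w => `|integral_functional mu f - det_output (A w) f| ^+ 2) =
        (fun w => (\int[mu]_x r f x -
                     n.+1%:R^-1 * \sum_(j < n.+1) r f (Y j w)) ^+ 2).
      apply/funext => w; rewrite real_normK ?num_real// outE opprD addrA.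
      congr ((_ - _) ^+ 2).
      rewrite /integral_functional -RintegralB//.
      exact: lipschitz_integrable.
    by rewrite unlock; exact: YE.
  rewrite lee_pmul2l// ?lte_fin ?invr_gt0 ?ltr0n//.
  apply: ge0_le_integral => //.
  - by move=> x _; rewrite lee_fin sqr_ge0.
  - exact/measurable_EFinP/measurable_funX.
  - exact/measurable_EFinP/measurable_funX.
  - by move=> x _; rewrite lee_fin.
by rewrite poweRM// poweR_EFin -[n.+1%:R^-1]powR_inv1// -powRrM mulN1r.
Qed.

End fixed_nodes.

Theorem theorem2 (R : realType) (X : completeNormedModType R)
    (mu : probability (borel X) R)
    (mu_moment1 : (\int[mu]_x `|(x : X)|%:E < +oo)%E)
    (n : nat) (n_gt0 : (0 < n)%N) :
  (minimal_ran_error mu (2 * n) <=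
     (2 * n%:R `^ (- 2^-1))%:E * quantization_number mu 2 n)%E.
Proof.
have c0 : 0 < n%:R `^ (- 2^-1) :> R by rewrite powR_gt0// ltr0n.
rewrite /quantization_number -ereal_inf_pZl ?mulr_gt0//.
apply/ereal_infP => _ [_ [a _ <-] <-].
apply: le_trans (minimal_ran_error_le_nodes mu_moment1 a n_gt0) _.
(* The bound for fixed nodes has constant 1, which is at most 2. *)
by rewrite lee_wpmul2r ?poweR_ge0// lee_fin ler_peMl ?ler1n// ltW.
Qed.
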